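(* Let $n\ge 1$ and let $A$ be a real $n\times n$ matrix. Then $\operatorname{dih}(A^T)=\operatorname{dih}(A)$, where $\operatorname{dih}$ denotes the dihedrant defined in the context.
   Context: For $n\ge1$ and $k=1,\dots,n$, let $\rho_k$ be the permutation of $\{1,\dots,n\}$ with $\rho_k(1)=k,\rho_k(2)=k+1,\dots,\rho_k(n-k+1)=n,\rho_k(n-k+2)=1,\dots,\rho_k(n)=k-1$ (the ''rotations''), and let $\mu_k$ be the permutation with $\mu_k(1)=k,\mu_k(2)=k-1,\dots,\mu_k(k)=1,\mu_k(k+1)=n,\mu_k(k+2)=n-1,\dots,\mu_k(n)=k+1$ (the ''reflections''). The set $D_n=\{\rho_k,\mu_k: k=1,\dots,n\}$ is the dihedral group, viewed as a set of permutations. Define $\operatorname{sig}(\rho_k)=1$ and $\operatorname{sig}(\mu_k)=-1$. For an $n\times n$ matrix $A=(a_{i,j})$, the dihedrant is $$\operatorname{dih}(A)=\sum_{k=1}^n\prod_{i=1}^n a_{i,\rho_k(i)}-\sum_{k=1}^n\prod_{i=1}^n a_{i,\mu_k(i)}.$$ (The sums run over the indices $k=1,\dots,n$, so for $n\le 2$ coinciding permutations are counted separately.) *)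

(* Defs.v *)
From HB Require Import structures.
From mathcomp Require Import all_boot all_order all_fingroup all_algebra.
From mathcomp Require Import zify.
From mathcomp Require Import reals.

Set Implicit Arguments.
Unset Strict Implicit.
Unset Printing Implicit Defensive.

Import GRing.Theory.
Local Open Scope ring_scope.

Section Dihedrant.
Variable n : nat.
Implicit Types k i : 'I_n.

(* Indices are shifted by one: the ordinals k and i stand for the 1-based     *)
(* indices k + 1 and i + 1, so 1-based rho_{k+1}(i+1) = k + i + 1 reads k + i *)
(* here, and 1-based mu_{k+1}(i+1) = k - i + 1 reads k - i; both wrap mod n.  *)
Definition rho_val (k i : nat) : nat :=
  (if k + i < n then k + i else k + i - n)%N.

Definition mu_val (k i : nat) : nat :=
  (if i <= k then k - i else n + k - i)%N.

Fact rho_subproof k i : (rho_val k i < n)%N.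
Proof. by rewrite /rho_val; case: ifP; have := ltn_ord k; have := ltn_ord i; lia. Qed.

Fact mu_subproof k i : (mu_val k i < n)%N.
Proof. by rewrite /mu_val; case: ifP; have := ltn_ord k; have := ltn_ord i; lia. Qed.

Definition rho_ord k i : 'I_n := Ordinal (rho_subproof k i).
Definition mu_ord k i : 'I_n := Ordinal (mu_subproof k i).

Fact rho_ord_inj k : injective (rho_ord k).
Proof.
move=> i j /(congr1 val) /=; rewrite /rho_val => eq_ij; apply: val_inj => /=.
by move: eq_ij; do 2 case: ifP; have := ltn_ord k; have := ltn_ord i; have := ltn_ord j; lia.
Qed.

Fact mu_ord_inj k : injective (mu_ord k).
Proof.
move=> i j /(congr1 val) /=; rewrite /mu_val => eq_ij; apply: val_inj => /=.
by move: eq_ij; do 2 case: ifP; have := ltn_ord k; have := ltn_ord i; have := ltn_ord j; lia.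
Qed.

Definition rho k : 'S_n := perm (@rho_ord_inj k).
Definition mu k : 'S_n := perm (@mu_ord_inj k).

(* The sums range over the index k, not over the set of permutations: for     *)
(* n <= 2, where some of the rho k and mu k coincide, each is counted.        *)
Definition dih (R : comNzRingType) (A : 'M[R]_n) : R :=
  \sum_(k < n) \prod_(i < n) A i (rho k i)
  - \sum_(k < n) \prod_(i < n) A i (mu k i).

End Dihedrant.

(* Main.v *)
Require Import Defs.
From HB Require Import structures.
From mathcomp Require Import all_boot all_order all_fingroup all_algebra.
From mathcomp Require Import zify.
From mathcomp Require Import reals.

Set Implicit Arguments.
Unset Strict Implicit.
Unset Printing Implicit Defensive.

Import GRing.Theory.
Local Open Scope ring_scope.

(** Transposing [A] replaces each permutation in the sum by its inverse.  The
    inverse of a rotation is the opposite rotation and a reflection is its own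
    inverse, so both sums are merely reindexed. *)

(** Replacing the row index [i] by [s i] turns the factor [A i (s^-1 i)] into [A (s i) i]. *)
Lemma prod_trmx_perm (R : comNzRingType) (n : nat) (A : 'M[R]_n) (s : 'S_n) :
  \prod_i A^T i (s i) = \prod_i A i (s^-1%g i).
Proof.
rewrite [RHS](reindex_inj (@perm_inj _ s)).
by apply: eq_bigr => i _; rewrite mxE permK.
Qed.

(** Modulo [n], [k - (k - i) = i]. *)
Lemma muV (n : nat) (k : 'I_n) : ((mu k)^-1 = mu k)%g.
Proof.
apply/permP => i; apply: (@perm_inj _ (mu k)); rewrite permKV !permE.
apply: val_inj; rewrite /= /mu_val.
by have := ltn_ord k; have := ltn_ord i; do 2 case: ifP; lia.
Qed.

(** Since [rho k] is translation by [k] modulo [n], its inverse is translation by [-k]; the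
    reflection [mu] at the ordinal 0 is the negation [k -> -k]. *)
Lemma rhoV (n : nat) (n_gt0 : (0 < n)%N) (k : 'I_n) :
  ((rho k)^-1 = rho (mu (Ordinal n_gt0) k))%g.
Proof.
apply/permP => i; apply: (@perm_inj _ (rho k)); rewrite permKV !permE.
apply: val_inj; rewrite /= /rho_val /= /mu_val.
by have := ltn_ord k; have := ltn_ord i; do 3 case: ifP; lia.
Qed.

Theorem theorem1 (R : realType) (n : nat) (hn : (1 <= n)%N) (A : 'M[R]_n) :
  dih A^T = dih A.
Proof.
rewrite /dih; congr (_ - _).
(* Negation of indices, being itself some [mu], is injective and so may reindex the rotations. *)
- rewrite [RHS](reindex_inj (@perm_inj _ (mu (Ordinal hn)))).
  by apply: eq_bigr => k _; rewrite prod_trmx_perm (rhoV hn).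
- by apply: eq_bigr => k _; rewrite prod_trmx_perm muV.
Qed.
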